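(* Consider the convex optimization problem $$\max_{\{p_n\}_{n\in\mathcal N}}\ \mu_u\sum_{n\in\mathcal N}\log_2\bigl(1+p_nF_u(n)\bigr)-\mu_g\sum_{n\in\mathcal N}B_n^{(r)}p_n\quad\text{s.t.}\quad \sum_{n\in\mathcal N}p_n\le P_{\max},\quad p_n\ge 0\ \ \forall n\in\mathcal N.$$ The optimal solution to this problem is given by $$p_n^{(r)*}=\begin{cases}\tilde p_n^{(r)}, & \text{if } \sum_{n\in\mathcal N}\tilde p_n^{(r)}\le P_{\max},\\[4pt] \left(\dfrac{\mu_u}{(\mu_gB_n^{(r)}+\nu)\ln 2}-\dfrac{1}{F_u(n)}\right)^+, & \text{otherwise,}\end{cases}$$ for all $n\in\mathcal N$, where $$\tilde p_n^{(r)}\triangleq\left(\frac{\mu_u}{\mu_gB_n^{(r)}\ln 2}-\frac{1}{F_u(n)}\right)^+,$$ and $\nu$ is a constant ensuring that $\sum_{n\in\mathcal N}p_n^{(r)*}=P_{\max}$.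
   Context: $\mathcal N=\{1,\dots,N\}$ is a finite set of resource blocks (RBs) and $\mathcal J=\{1,\dots,J\}$ is a finite set of base stations (BSs). For each $n\in\mathcal N$, $\mathcal J(n)\subseteq\mathcal J$ is the set of BSs at which RB $n$ is occupied by a ground user, and $\mathcal J^c(n)=\mathcal J\setminus\mathcal J(n)$, which is nonempty. $F_j(n)$ is the channel power gain from the UAV (unmanned aerial vehicle) to BS $j$ divided by the total power of background noise and residual interference at BS $j$ in RB $n$; $\gamma_j(n)$, for $j\in\mathcal J(n)$, is the receive signal-to-interference-plus-noise ratio, in the absence of the UAV's transmission, of the ground user served by BS $j$ in RB $n$; and $F_u(n)\triangleq\max_{j\in\mathcal J^c(n)}F_j(n)$. The constants $\mu_u\ge 0$ and $\mu_g\ge 0$ are the weights of the UAV's rate and of the ground users' sum-rate, $p_n$ is the UAV's transmit power in RB $n$, and $P_{\max}$ is the UAV's maximum transmit power. For a given UAV power allocation $\{p_n^{(r)}\}_{n\in\mathcal N}$ (the local point in the $r$-th iteration of a successive convex approximation algorithm), $$B_n^{(r)}=\sum_{j\in\mathcal J(n)}\frac{F_j(n)\gamma_j(n)}{\ln 2\,\bigl(1+p_n^{(r)}F_j(n)+\gamma_j(n)\bigr)\bigl(1+p_n^{(r)}F_j(n)\bigr)}.$$ Notation: $(x)^+\triangleq\max\{x,0\}$. *)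

(* Defs.v *)
From HB Require Import structures.
From mathcomp Require Import all_boot all_order all_algebra.
From mathcomp Require Import all_classical all_reals all_analysis.

Set Implicit Arguments.
Unset Strict Implicit.
Unset Printing Implicit Defensive.

Import Order.TTheory GRing.Theory Num.Theory.
Local Open Scope ring_scope.

(* Resource blocks are indexed by 'I_N and base stations by 'I_J; occ n is the
   set J(n) of base stations at which resource block n is occupied. *)

(* F_u(n): the default value 0 of the iterated maximum is harmless because the
   gains F_j(n) are nonnegative and the complement of occ n is nonempty. *)
Definition Fmax (R : realType) (N J : nat) (occ : 'I_N -> {set 'I_J})
    (F : 'I_J -> 'I_N -> R) (n : 'I_N) : R :=
  \big[Num.max/0]_(j | j \notin occ n) F j n.

(* B_n^(r), with pr the local point p^(r). *)
Definition Bcoef (R : realType) (N J : nat) (occ : 'I_N -> {set 'I_J})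
    (F gamma : 'I_J -> 'I_N -> R) (pr : 'I_N -> R) (n : 'I_N) : R :=
  \sum_(j in occ n)
    (F j n * gamma j n) /
    (ln 2 * (1 + pr n * F j n + gamma j n) * (1 + pr n * F j n)).

Definition log2 (R : realType) (x : R) : R := ln x / ln 2.

Definition objective (R : realType) (N : nat) (mu_u mu_g : R)
    (Fu B p : 'I_N -> R) : R :=
  mu_u * \sum_(n < N) log2 (1 + p n * Fu n) - mu_g * \sum_(n < N) B n * p n.

Definition feasible (R : realType) (N : nat) (Pmax : R) (p : 'I_N -> R) : Prop :=
  \sum_(n < N) p n <= Pmax /\ forall n, 0 <= p n.

Definition optimal (R : realType) (N : nat) (mu_u mu_g Pmax : R)
    (Fu B p : 'I_N -> R) : Prop :=
  feasible Pmax p /\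
  forall q, feasible Pmax q ->
    objective mu_u mu_g Fu B q <= objective mu_u mu_g Fu B p.

Local Open Scope ereal_scope.

(* (mu_u / (c ln 2) - 1 / f)^+ as an extended real. In \bar R one has
   0^-1 = +oo and 0 * +oo = 0, so the value is +oo if c = 0 < mu_u and 0 < f
   (which happens for mu_g B_n = 0), and it is 0 if mu_u = 0 <= c or
   f = 0 <= c, using +oo - +oo = -oo. *)
Definition water_level (R : realType) (mu_u c f : R) : \bar R :=
  maxe (mu_u%:E / (c * ln 2)%:E - f%:E^-1) 0.

Definition ptilde (R : realType) (N : nat) (mu_u mu_g : R)
    (Fu B : 'I_N -> R) (n : 'I_N) : \bar R :=
  water_level mu_u (mu_g * B n) (Fu n).

Definition pstar (R : realType) (N : nat) (mu_u mu_g Pmax : R)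
    (Fu B : 'I_N -> R) (nu : R) (n : 'I_N) : \bar R :=
  if \sum_(m < N) ptilde mu_u mu_g Fu B m <= Pmax%:E
  then ptilde mu_u mu_g Fu B n
  else water_level mu_u (mu_g * B n + nu) (Fu n).

(* Main.v *)
(** Lagrangian duality with a single multiplier [nu] for the power budget: after
    adding [nu] to the prices [mu_g B_n] the objective separates over the
    blocks, and the water level maximizes each term, because
    [ln x <= x - 1], applied to the ratio of the two arguments of the logarithm,
    is the tangent-line inequality at that level. Complementary slackness
    transfers optimality back to the constrained problem, and strictness of
    [ln x < x - 1] for [x <> 1] gives uniqueness. The multiplier exists by the
    intermediate value theorem: the total level is continuous in [nu], vanishes
    for large [nu], and is at least [Pmax] at a suitable starting point, which
    has to be positive when some unconstrained level is infinite. *)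
Require Import Defs.
From HB Require Import structures.
From mathcomp Require Import all_boot all_order all_algebra.
From mathcomp Require Import all_classical all_reals all_analysis.
From mathcomp Require Import ring lra.

Set Implicit Arguments.
Unset Strict Implicit.
Unset Printing Implicit Defensive.

Import Order.TTheory GRing.Theory Num.Theory.
Import numFieldNormedType.Exports.
Local Open Scope ring_scope.

(** The term of one block in the Lagrangian, at a price [c] that includes the multiplier. *)
Definition rate (R : realType) (mu c f p : R) : R :=
  mu * log2 (1 + p * f) - c * p.

(* The real form of [water_level] where that is finite; the case distinction is
   there because [f^-1] is [0] at [f = 0] in the field, but [+oo] in [\bar R]. *)
Definition level (R : realType) (mu c f : R) : R :=
  if mu * f == 0 then 0 else Num.max (mu / (c * ln 2) - f^-1) 0.

(** * Maximizing the Lagrangian term of a single block *)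

Section SingleBlock.
Context (R : realType).
Implicit Types mu c f p w x : R.

Lemma ln2_gt0 : 0 < ln 2 :> R.
Proof. by rewrite ln_gt0// ltr1n. Qed.

Lemma lt_ln_sub1 x : 0 < x -> x != 1 -> ln x < x - 1.
Proof.
move=> x0 x1; have lx0 : ln x != 0 by rewrite ln_eq0.
by have := expR_gt1Dx lx0; rewrite lnK ?posrE// => ?; lra.
Qed.

Lemma le_ln_sub1 x : 0 < x -> ln x <= x - 1.
Proof.
move=> x0; have [->|x1] := eqVneq x 1; first by rewrite ln1 subrr.
exact/ltW/lt_ln_sub1.
Qed.

Lemma level_ge0 mu c f : 0 <= level mu c f.
Proof. by rewrite /level; case: ifP => // _; rewrite le_max lexx orbT. Qed.

Lemma water_level_ge0 mu c f : (0 <= water_level mu c f)%E.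
Proof. by rewrite /water_level le_max lexx orbT. Qed.

(** The last hypothesis rules out exactly the infinite case: a zero price on a block with positive
    [mu * f]. *)
Lemma water_level_fin mu c f : 0 <= mu -> 0 <= c -> 0 <= f ->
  (0 < mu * f -> 0 < c) -> water_level mu c f = (level mu c f)%:E.
Proof.
move=> mu0 c0 f0 muf_c; rewrite /water_level /level !inver.
have ln20 := ln2_gt0.
have [->|f_neq0] := eqVneq f 0.
  rewrite mulr0 eqxx; case: ifP => _; last first.
    by rewrite -EFinM addeNy maxNye.
  have [->|mu_neq0] := eqVneq mu 0; first by rewrite mul0e addeNy maxNye.
  by rewrite gt0_muley ?lte_fin ?lt0r ?mu_neq0// addeNy maxNye.
have f_gt0 : 0 < f by rewrite lt0r f_neq0.
have [->|mu_neq0] := eqVneq mu 0.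
  rewrite mul0r eqxx mul0e add0e -EFinN -EFin_max; congr (_%:E).
  by apply/max_r; rewrite oppr_le0 invr_ge0.
have mu_gt0 : 0 < mu by rewrite lt0r mu_neq0.
have c_gt0 := muf_c (mulr_gt0 mu_gt0 f_gt0).
rewrite !mulf_eq0 (negbTE mu_neq0) (negbTE f_neq0) (gt_eqF c_gt0).
by rewrite (gt_eqF ln20)/= -EFinM -EFinB -EFin_max.
Qed.

Lemma water_level_pinfty mu f : 0 < mu * f -> 0 <= f ->
  water_level mu 0 f = +oo%E.
Proof.
move=> muf f0.
have f_gt0 : 0 < f.
  by rewrite lt0r f0 andbT; apply: contraTneq muf => ->; rewrite mulr0 ltxx.
have mu_gt0 : 0 < mu by rewrite -(pmulr_lgt0 _ f_gt0).
rewrite /water_level mul0r !inver eqxx (gt_eqF f_gt0).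
by rewrite gt0_muley ?lte_fin// -EFinN addye// maxye.
Qed.

Lemma water_level_fin_numP mu c f : 0 <= mu -> 0 <= c -> 0 <= f ->
  water_level mu c f \is a fin_num -> 0 < mu * f -> 0 < c.
Proof.
move=> mu0 c0 f0 fw muf; rewrite lt0r c0 andbT; apply: contraTneq fw => ->.
by rewrite water_level_pinfty.
Qed.

(* The slope of [p |-> mu * log2 (1 + p * f)] at [level mu c f] is [c], or at
   most [c] when the level is [0]. *)
Lemma level_slope mu c f p : 0 <= mu -> 0 <= c -> 0 <= f ->
  (0 < mu * f -> 0 < c) -> 0 <= p ->
  mu / ln 2 * ((1 + p * f) / (1 + level mu c f * f) - 1)
    <= c * (p - level mu c f).
Proof.
move=> mu0 c0 f0 muf_c p0; rewrite /level; have ln20 := ln2_gt0.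
case: ifPn => [/eqP muf|muf_neq0].
  rewrite mul0r addr0 divr1 addrAC subrr add0r subr0.
  rewrite (_ : _ * _ = (mu * f) * (p / ln 2)); last by ring.
  by rewrite muf mul0r mulr_ge0.
have muf : 0 < mu * f by rewrite lt0r muf_neq0 mulr_ge0.
have f_gt0 : 0 < f.
  by rewrite lt0r f0 andbT; apply: contraTneq muf => ->; rewrite mulr0 ltxx.
have mu_gt0 : 0 < mu by rewrite -(pmulr_lgt0 _ f_gt0).
have c_gt0 := muf_c muf.
case: (leP (mu / (c * ln 2) - f^-1) 0) => [|_].
  rewrite subr_le0 ler_pdivrMr ?mulr_gt0// => h.
  rewrite mul0r addr0 divr1 addrAC subrr add0r subr0 mulrCA mulrC ler_wpM2r//.
  rewrite mulrAC ler_pdivrMr// -ler_pdivlMr// (le_trans h)//.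
  by rewrite mulrC.
(* When the maximum is attained by its first argument, [1 + level * f] is [mu * f / (c * ln 2)], and
   both sides agree. *)
rewrite le_eqVlt; apply/orP; left; apply/eqP; field.
by rewrite mulN1r addrC subrK muf_neq0 !gt_eqF.
Qed.

Lemma rate_sub mu c f p w : 0 <= f -> 0 <= p -> 0 <= w ->
  rate mu c f p - rate mu c f w =
  mu / ln 2 * ln ((1 + p * f) / (1 + w * f)) - c * (p - w).
Proof.
move=> f0 p0 w0; rewrite ln_div ?posrE ?ltr_pwDl ?mulr_ge0// /rate /log2.
by ring.
Qed.

Lemma rate_le mu c f p : 0 <= mu -> 0 <= c -> 0 <= f ->
  (0 < mu * f -> 0 < c) -> 0 <= p ->
  rate mu c f p <= rate mu c f (level mu c f).
Proof.
move=> mu0 c0 f0 muf_c p0; rewrite -subr_le0 rate_sub ?level_ge0// subr_le0.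
apply: le_trans (level_slope mu0 c0 f0 muf_c p0).
apply: ler_wpM2l; first by rewrite divr_ge0// ltW// ln2_gt0.
by apply: le_ln_sub1; rewrite divr_gt0 ?ltr_pwDl ?mulr_ge0 ?level_ge0.
Qed.

Lemma rate_lt mu c f p : 0 <= mu -> 0 < c -> 0 <= f -> 0 <= p ->
  p != level mu c f -> rate mu c f p < rate mu c f (level mu c f).
Proof.
move=> mu0 c0 f0 p0 pNl.
(* If [mu * f = 0] the rate is just [- c * p], so strictness comes from [0 < c] and not from the
   logarithm. *)
have [muf|muf_neq0] := eqVneq (mu * f) 0.
  move: pNl; rewrite /level muf eqxx => pN0.
  rewrite /rate !mul0r addr0 /log2 ln1 mul0r !mulr0 subrr.
  have -> : mu * (ln (1 + p * f) / ln 2) = 0.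
    by move/eqP: muf; rewrite mulf_eq0 => /orP[]/eqP->;
      rewrite ?mul0r// mulr0 addr0 ln1 mul0r mulr0.
  by rewrite sub0r oppr_lt0 mulr_gt0// lt0r pN0.
have [mu_gt0 f_gt0] : 0 < mu /\ 0 < f.
  move: muf_neq0; rewrite mulf_eq0 negb_or => /andP[? ?].
  by rewrite !lt0r mu0 f0 !andbT.
rewrite -subr_lt0 rate_sub ?level_ge0// subr_lt0.
apply: lt_le_trans (level_slope mu0 (ltW c0) f0 (fun=> c0) p0).
have den : 0 < 1 + level mu c f * f by rewrite ltr_pwDl ?mulr_ge0 ?level_ge0.
rewrite ltr_pM2l ?divr_gt0 ?ln2_gt0//.
apply: lt_ln_sub1; first by rewrite divr_gt0 ?ltr_pwDl ?mulr_ge0 ?level_ge0.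
have f_neq0 := lt0r_neq0 f_gt0.
by rewrite -(inj_eq (mulIf (lt0r_neq0 den))) divfK ?lt0r_neq0// mul1r (inj_eq (addrI 1))
  (inj_eq (mulIf f_neq0)).
Qed.

Lemma level_continuous mu b f x : 0 < b + x ->
  {for x, continuous (fun y => level mu (b + y) f)}.
Proof.
move=> bx; rewrite /level; case: (mu * f == 0); first exact: cvg_cst.
apply: (@continuous_max R R (fun y => mu / ((b + y) * ln 2) - f^-1) (fun=> 0)).
  apply: cvgB; last exact: cvg_cst.
  apply: cvgM; first exact: cvg_cst.
  apply: cvgV; first by rewrite gt_eqF// mulr_gt0// ln2_gt0.
  by apply: cvgM; [apply: cvgD; [exact: cvg_cst|exact: cvg_id]|exact: cvg_cst].
exact: cvg_cst.
Qed.

(** The marginal rate at zero power is [mu * f / ln 2]; at a price at least that high no power pays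
    off. *)
Lemma level_eq0 mu c f : 0 <= mu -> 0 <= f -> 0 < c -> mu * f <= c * ln 2 ->
  level mu c f = 0.
Proof.
move=> mu0 f0 c0 le_c; rewrite /level; case: ifPn => // muf.
have f_gt0 : 0 < f.
  by rewrite lt0r f0 andbT; apply: contraNneq muf => ->; rewrite mulr0.
apply: max_r; rewrite subr_le0 ler_pdivrMr ?mulr_gt0 ?ln2_gt0//.
by rewrite mulrC ler_pdivlMr.
Qed.
End SingleBlock.

(** * Existence of the multiplier *)

Section TotalLevel.
Context (R : realType) (N : nat) (mu P : R) (b f : 'I_N -> R).
Hypotheses (mu_ge0 : 0 <= mu) (P_ge0 : 0 <= P).
Hypotheses (b_ge0 : forall n, 0 <= b n) (f_ge0 : forall n, 0 <= f n).

Let lev nu n := level mu (b n + nu) (f n).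

(** Supplies the left endpoint for the intermediate value theorem; the positivity clause keeps the
    levels continuous from [a] on. *)
Lemma level_sum_ge : (P%:E < \sum_(n < N) water_level mu (b n) (f n))%E ->
  exists a, [/\ 0 <= a, forall n, 0 < mu * f n -> 0 < b n + a &
                P <= \sum_(n < N) lev a n].
Proof.
move=> P_lt; have [b_gt0|] := pselect (forall n, 0 < mu * f n -> 0 < b n).
  exists 0; split=> // [n|]; first by rewrite addr0; exact: b_gt0.
  move: P_lt; under eq_bigr do rewrite (water_level_fin _ _ _ (b_gt0 _))//.
  rewrite sumEFin lte_fin => /ltW/le_trans; apply.
  by rewrite (eq_bigr (lev 0))// => n _; rewrite /lev addr0.
move=> /existsNP[m /not_implyP[muf_gt0 /negP]]; rewrite lt0r b_ge0 andbT negbK.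
move=> /eqP bm0.
have ln20 := @ln2_gt0 R.
have fm : 0 < f m.
  rewrite lt0r f_ge0 andbT.
  by apply: contraTneq muf_gt0 => ->; rewrite mulr0 ltxx.
have mu_gt0 : 0 < mu by rewrite -(pmulr_lgt0 _ fm).
have d_gt0 : 0 < P + (f m)^-1 by rewrite ltr_wpDl ?invr_gt0.
(* Block [m] has price zero; this starting point solves [mu / (a * ln 2) - (f m)^-1 = P], so block
   [m] alone reaches [P]. *)
have a_gt0 : 0 < mu / ln 2 / (P + (f m)^-1) by rewrite !divr_gt0.
exists (mu / ln 2 / (P + (f m)^-1)); split=> [|n _|]; first exact: ltW.
  by rewrite ltr_wpDl.
rewrite (bigD1 m)//= -[leLHS]addr0 lerD//; last first.
  by apply: sumr_ge0 => n _; exact: level_ge0.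
rewrite /lev /level bm0 add0r gt_eqF// le_max; apply/orP; left.
rewrite le_eqVlt; apply/orP; left; apply/eqP; field.
by rewrite !gt_eqF// ltr_wpDl// mulr_ge0// ltW.
Qed.

Lemma level_sum_eq : (P%:E < \sum_(n < N) water_level mu (b n) (f n))%E ->
  exists nu, [/\ 0 <= nu, forall n, 0 < mu * f n -> 0 < b n + nu &
                 \sum_(n < N) lev nu n = P].
Proof.
move=> /level_sum_ge[a [a_ge0 a_gt0 P_le]].
(* The sum dominates each threshold of [level_eq0], so all levels vanish at [e]; the [1] makes [e]
   positive and larger than [a]. *)
pose e := a + 1 + \sum_(n < N) mu * f n / ln 2.
have term_ge0 n : 0 <= mu * f n / ln 2.
  by rewrite divr_ge0 ?mulr_ge0// ltW ?ln2_gt0.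
have s_ge0 : 0 <= \sum_(n < N) mu * f n / ln 2 by apply: sumr_ge0.
have a_lt_e : a < e by rewrite /e; lra.
have lev_e : \sum_(n < N) lev e n = 0.
  apply: big1 => n _; apply: level_eq0 => //.
    by rewrite ltr_wpDl// (le_lt_trans a_ge0).
  rewrite -ler_pdivrMr ?ln2_gt0// (@le_trans _ _ e)// ?lerDr//.
  rewrite /e (bigD1 n)//= addrCA lerDl addr_ge0//; first by lra.
  exact: sumr_ge0.
have : {within `[a, e], continuous (fun x => \sum_(n < N) lev x n)}%classic.
  apply: continuous_in_subspaceT => x; rewrite inE/= in_itv/= => /andP[ax _].
  apply: cvg_big => [|n _]; first exact: add_continuous.
  have [muf|muf_neq0] := eqVneq (mu * f n) 0.
    rewrite /lev /level muf eqxx; exact: cvg_cst.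
  apply: level_continuous.
  by rewrite (lt_le_trans (a_gt0 n _)) ?lerD2l// lt0r muf_neq0 mulr_ge0.
move=> /(@IVT _ _ _ _ P (ltW a_lt_e))[].
  by rewrite lev_e ge_min le_max P_ge0 orbT P_le.
move=> nu; rewrite in_itv/= => /andP[a_nu _] <-; exists nu; split=> //.
  exact: le_trans a_nu.
by move=> n /a_gt0/lt_le_trans; apply; rewrite lerD2l.
Qed.

End TotalLevel.

(** * Sufficiency of the optimality conditions, and uniqueness *)

Section Optimality.
Context (R : realType) (N : nat) (mu mu_g P nu : R) (B f : 'I_N -> R).
Hypotheses (mu_ge0 : 0 <= mu) (nu_ge0 : 0 <= nu).
Hypotheses (B_ge0 : forall n, 0 <= mu_g * B n) (f_ge0 : forall n, 0 <= f n).

Let c n := mu_g * B n + nu.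
Let w n := level mu (c n) (f n).

Hypothesis c_gt0 : forall n, 0 < mu * f n -> 0 < c n.
Hypotheses (w_le : \sum_(n < N) w n <= P).
Hypotheses (w_slack : nu * (P - \sum_(n < N) w n) = 0).

Lemma objective_rate p : objective mu mu_g f B p =
  \sum_(n < N) rate mu (c n) (f n) (p n) + nu * \sum_(n < N) p n.
Proof.
rewrite /objective !mulr_sumr -sumrB -big_split/=; apply: eq_bigr => n _.
by rewrite /rate /c; ring.
Qed.

Let c_ge0 n : 0 <= c n. Proof. by rewrite addr_ge0. Qed.

(** By complementary slackness the right-hand side is [nu * P], which leaves only the budget
    constraint on [q]. *)
Let slack q : feasible P q -> nu * \sum_(n < N) q n <= nu * \sum_(n < N) w n.
Proof.
move=> [q_le _]; move/eqP: w_slack; rewrite mulrBr subr_eq0 => /eqP <-.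
exact: ler_wpM2l.
Qed.

Lemma level_optimal : optimal mu mu_g P f B w.
Proof.
split=> [|q qP]; first by split=> // n; exact: level_ge0.
rewrite !objective_rate lerD ?slack// ler_sum// => n _.
by apply: rate_le => //; [exact: c_gt0|exact: qP.2].
Qed.

(** A block where [q] differs from [w] loses strictly, while neither the other blocks nor the budget
    term can make up for it. *)
Lemma level_optimal_unique q : (forall n, 0 < c n) ->
  optimal mu mu_g P f B q -> q =1 w.
Proof.
move=> cpos [qP /(_ _ level_optimal.1)]; rewrite !objective_rate => le_q n.
apply/eqP; apply: contraPT le_q => qNw; apply/negP; rewrite -ltNge.
apply: ltr_leD (slack qP); rewrite (bigD1 n)//= [ltRHS](bigD1 n)//=.
apply: ltr_leD; first by apply: rate_lt => //; exact: qP.2.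
by apply: ler_sum => i _; apply: rate_le => //; exact: qP.2.
Qed.

End Optimality.

(** The first conjunct shows that a suitable [nu] exists when the budget binds. Uniqueness needs
    nondegeneracy: if [mu_u * Fu n] and [mu_g * B n] both vanish, the objective ignores the power in
    block [n]. *)
Theorem proposition1 (R : realType) (N J : nat) (occ : 'I_N -> {set 'I_J})
    (F gamma : 'I_J -> 'I_N -> R) (mu_u mu_g Pmax : R) (pr : 'I_N -> R)
    (occC_neq0 : forall n, exists j, j \notin occ n)
    (F_ge0 : forall j n, 0 <= F j n)
    (gamma_ge0 : forall n j, j \in occ n -> 0 <= gamma j n)
    (mu_u_ge0 : 0 <= mu_u) (mu_g_ge0 : 0 <= mu_g) (Pmax_ge0 : 0 <= Pmax)
    (pr_ge0 : forall n, 0 <= pr n) :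
  let Fu := Fmax occ F in
  let B := Bcoef occ F gamma pr in
  let pt := ptilde mu_u mu_g Fu B in
  let ps := pstar mu_u mu_g Pmax Fu B in
  ((Pmax%:E < \sum_(n < N) pt n)%E ->
     exists nu : R, 0 <= nu /\ (\sum_(n < N) ps nu n)%E = Pmax%:E) /\
  forall nu : R,
    ((Pmax%:E < \sum_(n < N) pt n)%E ->
       0 <= nu /\ (\sum_(n < N) ps nu n)%E = Pmax%:E) ->
    [/\ forall n, ps nu n \is a fin_num,
        optimal mu_u mu_g Pmax Fu B (fun n => fine (ps nu n)) &
        (forall n, 0 < mu_u * Fu n \/ 0 < mu_g * B n) ->
        forall q, optimal mu_u mu_g Pmax Fu B q ->
        forall n, q n = fine (ps nu n)].
Proof.
move=> Fu B pt ps.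
have Fu_ge0 n : 0 <= Fu n by exact: bigmax_ge_id.
have B_ge0 n : 0 <= B n.
  apply: sumr_ge0 => j /gamma_ge0 g0.
  by rewrite !(divr_ge0, mulr_ge0, addr_ge0)// ltW// ln2_gt0.
have b_ge0 n : 0 <= mu_g * B n by rewrite mulr_ge0.
have ps_gt nu n : (Pmax%:E < \sum_(n < N) pt n)%E ->
    ps nu n = water_level mu_u (mu_g * B n + nu) (Fu n).
  by rewrite ltNge => /negbTE P_lt; rewrite /ps /pstar P_lt.
split=> [P_lt|nu nuP].
  have [nu [nu_ge0 c_gt0 sumP]] :=
    level_sum_eq mu_u_ge0 Pmax_ge0 b_ge0 Fu_ge0 P_lt.
  exists nu; split=> //; rewrite -sumP -sumEFin; apply: eq_bigr => n _.
  by rewrite ps_gt// water_level_fin// ?addr_ge0//; exact: c_gt0.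
(* Both branches of [pstar] are water levels for one multiplier [nu']: zero if the unconstrained
   levels fit the budget, [nu] otherwise. *)
have [nu' [nu'_ge0 psE sum_le slack]] : exists nu', [/\ 0 <= nu',
    forall n, ps nu n = water_level mu_u (mu_g * B n + nu') (Fu n),
    (\sum_(n < N) ps nu n <= Pmax%:E)%E &
    nu' = 0 \/ (\sum_(n < N) ps nu n = Pmax%:E)%E].
  have [P_ge|P_lt] := leP (\sum_(n < N) pt n)%E Pmax%:E.
    have psE n : ps nu n = pt n by rewrite /ps /pstar P_ge.
    exists 0; split=> // [n| |]; first by rewrite addr0 psE.
      by under eq_bigr do rewrite psE.
    by left.
  have [nu_ge0 sumP] := nuP P_lt.
  by exists nu; split=> // [n| |]; [exact: ps_gt|rewrite sumP|right].
(* Each term of a nonnegative sum bounded by [Pmax] is finite, and finiteness in turn forces the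
   positive prices of [c_gt0]. *)
have ps_fin n : ps nu n \is a fin_num.
  rewrite ge0_fin_numE ?psE ?water_level_ge0//.
  apply: le_lt_trans (ltry Pmax); apply: le_trans sum_le.
  rewrite (bigD1 n)//= -psE leeDl// sume_ge0// => m _.
  by rewrite psE water_level_ge0.
have c_gt0 n : 0 < mu_u * Fu n -> 0 < mu_g * B n + nu'.
  by apply: water_level_fin_numP; rewrite // -?psE// addr_ge0.
have ps_level n : ps nu n = (level mu_u (mu_g * B n + nu') (Fu n))%:E.
  by rewrite psE water_level_fin// ?addr_ge0//; exact: c_gt0.
have fineE : (fun n => fine (ps nu n)) =
    (fun n => level mu_u (mu_g * B n + nu') (Fu n)).
  by apply/funext => n; rewrite ps_level.
move: sum_le slack; rewrite (eq_bigr _ (fun n _ => ps_level n)) sumEFin lee_fin.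
move=> sum_le slack.
have {}slack :
    nu' * (Pmax - \sum_(n < N) level mu_u (mu_g * B n + nu') (Fu n)) = 0.
  by case: slack => [->|[->]]; rewrite ?mul0r// subrr mulr0.
split=> //; first by rewrite fineE; exact: level_optimal.
move=> nondegenerate q q_opt n; rewrite ps_level/=.
apply: (level_optimal_unique (mu := mu_u) (P := Pmax)) q_opt n => // n.
by have [/c_gt0//|b_gt0] := nondegenerate n; rewrite ltr_wpDr.
Qed.
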